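(* Let $n\ge 2$ and let $M\in\{\mathbf{U}(n,\mathbb{N}),\mathbf{P}(n,\mathbb{N})\}$. If $S$ is a unipotent numerical monoid in $M$, then $$\left\lfloor \frac{\mathtt{r}_M(S)}{2}\right\rfloor \ \le\ \mathtt{g}_M(S)\ <\ \mathtt{c}_M(S).$$
   Context: $\mathbb{N}=\{0,1,2,\dots\}$. $\mathbf{U}(n,\mathbb{N})$ is the monoid (under matrix multiplication) of upper triangular $n\times n$ matrices with entries in $\mathbb{N}$ and all diagonal entries equal to $1$. $\mathbf{P}(n,\mathbb{N})$ is the submonoid of those matrices whose only possibly nonzero off-diagonal entries lie in the first row. A unipotent numerical monoid in $M$ is a submonoid $S$ of $M$ such that $M\setminus S$ is finite. For a positive integer $k$, $\mathbf{U}(n,\mathbb{N})_k:=\{(x_{ij})\in \mathbf{U}(n,\mathbb{N}) : k\le \max_{1\le i,j\le n} x_{ij}\}\cup\{\mathbf{1}_n\}$, where $\mathbf{1}_n$ is the identity matrix. The generating number $\mathtt{r}_M(S)$ is the smallest positive integer $k$ such that $\mathbf{U}(n,\mathbb{N})_k\cap M\subseteq S$. The genus is $\mathtt{g}_M(S):=|M\setminus S|$. The conductor is $\mathtt{c}_M(S):=\mathtt{r}_M(S)^{d}$, where $d=\binom{n}{2}$ if $M=\mathbf{U}(n,\mathbb{N})$ and $d=n-1$ if $M=\mathbf{P}(n,\mathbb{N})$ (the dimension of the corresponding complex algebraic group). *)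

(* Defs.v *)
From mathcomp Require Import all_boot all_order all_algebra.
From mathcomp Require Import finmap.
From mathcomp Require Import mathcomp_extra boolp classical_sets functions cardinality.

Local Open Scope classical_set_scope.
Local Open Scope nat_scope.

(* U(n, N) *)
Definition Umon (n : nat) : set 'M[nat]_n :=
  [set x | (forall i j : 'I_n, j < i -> x i j = 0) /\
           (forall i : 'I_n, x i i = 1)].

(* P(n, N); row indices in 'I_n start at 0. *)
Definition Pmon (n : nat) : set 'M[nat]_n :=
  [set x | Umon n x /\
           (forall i j : 'I_n, i != j -> (i : nat) != 0 -> x i j = 0)].

Inductive ambient := AmbU | AmbP.

Definition carrier (t : ambient) (n : nat) : set 'M[nat]_n :=
  match t with AmbU => Umon n | AmbP => Pmon n end.

(* Dimension of the corresponding complex algebraic group. *)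
Definition ambient_dim (t : ambient) (n : nat) : nat :=
  match t with AmbU => 'C(n, 2) | AmbP => n.-1 end.

Definition submonoid {n : nat} (M S : set 'M[nat]_n) : Prop :=
  [/\ S `<=` M, S 1%:M%R & forall x y, S x -> S y -> S (x *m y)%R].

Definition unipotent_numerical_monoid {n : nat} (M S : set 'M[nat]_n) : Prop :=
  submonoid M S /\ finite_set (M `\` S).

Definition max_entry {n : nat} (x : 'M[nat]_n) : nat :=
  \max_(i < n) \max_(j < n) x i j.

(* U(n, N)_k *)
Definition Umon_ge (n k : nat) : set 'M[nat]_n :=
  [set x | Umon n x /\ k <= max_entry x] `|` [set 1%:M%R].

Definition is_generating_number {n : nat} (M S : set 'M[nat]_n) (k : nat) :
    Prop :=
  let P k := 0 < k /\ Umon_ge n k `&` M `<=` S in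
  P k /\ forall l, P l -> k <= l.

(* The junk value is 0 when no positive k works; this does not happen for a
   unipotent numerical monoid (generating_numberP below). *)
Definition generating_number {n : nat} (M S : set 'M[nat]_n) : nat :=
  xget 0 [set k | is_generating_number M S k].

(* Cardinality of M \ S, when this set is finite. *)
Definition genus {n : nat} (M S : set 'M[nat]_n) : nat :=
  #|` fset_set (M `\` S)|%fset.

Definition conductor (t : ambient) {n : nat} (S : set 'M[nat]_n) : nat :=
  generating_number (carrier t n) S ^ ambient_dim t n.

Lemma generating_numberP {n : nat} (M S : set 'M[nat]_n) :
  unipotent_numerical_monoid M S ->
  is_generating_number M S (generating_number M S).
Proof.
move=> [[_ S1 _] fMS]; rewrite /generating_number.
case: xgetP => [_ -> // | noP].
have exP : exists k, `[< 0 < k /\ Umon_ge n k `&` M `<=` S >].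
  pose k := (\max_(x <- fset_set (M `\` S)) max_entry x).+1.
  exists k; apply/asboolP; split=> // x [[[_ kx]|-> //] Mx].
  apply: contrapT => nSx.
  have xMS : x \in fset_set (M `\` S) by rewrite in_fset_set // inE.
  suff : max_entry x < k by rewrite ltnNge kx.
  by rewrite ltnS; apply: leq_bigmax_seq.
exfalso; apply: (noP (ex_minn exP)); case: ex_minnP => m /asboolP Pm mmin.
by split=> // l Pl; apply: mmin; apply/asboolP.
Qed.

(* Main.v *)
(** Upper bound: an element of [M \ S] has all its entries below [r], hence is
    determined by [d] digits in [{0, ..., r-1}], and the identity is not in
    [M \ S].

    Lower bound: some gap [x] has an entry [x i j >= r - 1] with [i < j].
    Cutting after row [i] writes [x] as [[A, B], [0, C]], and for every
    decomposition [B = B' + B''] the matrix [x] is the product of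
    [[1, B'], [0, C]] and [[A, B''], [0, 1]].  Taking [B'] to be [a] times an
    elementary matrix at [(i, j)], for [0 <= a < r], at least one factor is a
    gap; as the entry at [(i, j)] recovers [a] from either factor, [r] is at
    most twice the genus. *)
Require Import Defs.
From mathcomp Require Import all_boot all_order all_algebra.
From mathcomp Require Import finmap.
From mathcomp Require Import boolp classical_sets cardinality.
From mathcomp Require Import zify.

Import GRing.Theory.

Local Open Scope classical_set_scope.
Local Open Scope nat_scope.

Section MaxEntry.
Variable n : nat.
Implicit Types x : 'M[nat]_n.

Lemma leq_max_entry x i j : x i j <= max_entry x.
Proof.
apply: leq_trans (leq_bigmax (F := fun i => \max_(j < n) x i j) i).
exact: (leq_bigmax (F := fun j => x i j)).
Qed.

Lemma max_entry_attained x : 0 < n -> exists i j, max_entry x = x i j.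
Proof.
move=> n0; have ord_n : 0 < #|'I_n| by rewrite card_ord.
have [i maxi] := eq_bigmax (fun i => \max_(j < n) x i j) ord_n.
have [j maxj] := eq_bigmax (fun j => x i j) ord_n.
by exists i, j; rewrite /max_entry maxi maxj.
Qed.

Lemma Umon_eq1 x : Umon n x -> (forall i j : 'I_n, i < j -> x i j = 0) ->
  x = 1%:M%R.
Proof.
move=> [xlow xdiag] xup; apply/matrixP => i j; rewrite mxE.
have [ij|ji|/val_inj <-] := ltngtP i j.
- by rewrite xup // -val_eqE ltn_eqF.
- by rewrite xlow // -val_eqE gtn_eqF.
- by rewrite xdiag eqxx.
Qed.

(** For [k > 1] the maximal entry can lie neither on nor below the diagonal. For [k <= 1] it may be
    a diagonal [1], so a nonzero entry above the diagonal, which exists because [x] is not the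
    identity, replaces it. *)
Lemma Umon_large_entry x k : Umon n x -> x <> 1%:M%R -> k <= max_entry x ->
  exists i j : 'I_n, i < j /\ maxn k 1 <= x i j.
Proof.
move=> Ux x1 kx; have [xlow xdiag] := Ux.
have [i0 [j0 [ij0 x0]]] : exists i j : 'I_n, i < j /\ 0 < x i j.
  apply: contrapT => nex; apply: x1; apply: Umon_eq1 => // i j ij.
  apply/eqP; rewrite -leqn0 leqNgt; apply/negP => xij.
  by apply: nex; exists i, j.
have n0 : 0 < n by apply: leq_ltn_trans (ltn_ord i0).
have [k1|k1] := leqP k 1.
  by exists i0, j0.
have [i [j xij]] := max_entry_attained x n0.
exists i, j; rewrite -xij; split=> //.
rewrite ltnNge leq_eqVlt; apply/negP => /orP[/eqP/val_inj ji|ji].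
  by move: kx; rewrite xij ji xdiag leqNgt k1.
by move: kx; rewrite xij xlow // leqNgt ltnW.
Qed.

End MaxEntry.

Section Factorization.
Variables (n : nat) (x : 'M[nat]_n) (i j : 'I_n).

(** The block matrix [[1, B'], [0, C]], where [B'] is [a] at [(i, j)] and zero elsewhere;
    [upper_factor] is its partner [[A, B''], [0, 1]]. *)
Definition lower_factor (a : nat) : 'M[nat]_n :=
  \matrix_(p, q) if p <= i then (p == q) + a * ((p == i) && (q == j)) else x p q.

Definition upper_factor (a : nat) : 'M[nat]_n :=
  \matrix_(p, q) if p <= i then x p q - a * ((p == i) && (q == j)) else p == q.

Hypotheses (Ux : Umon n x) (ij : i < j).

(** The block product is [[A, B' + B''], [0, C]]; the bound on [a] makes the truncated subtraction
    in [B''] exact. *)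
Lemma factorsK a : a <= x i j -> (lower_factor a *m upper_factor a)%R = x.
Proof.
move=> ax; have [xlow _] := Ux.
apply/matrixP => p q; rewrite mxE.
have [ip|pi] := ltnP i p.
  rewrite (bigD1 q) //= big1 => [|l lq]; rewrite !mxE leqNgt ip /=.
    have [qi|iq] := leqP q i; last by rewrite eqxx addr0 mulr1.
    by rewrite xlow ?mul0r ?addr0 // (leq_ltn_trans qi).
  have [li|il] := leqP l i; last by rewrite (negPf lq) mulr0.
  by rewrite xlow ?mul0r // (leq_ltn_trans li).
have pj : p != j by rewrite -val_eqE ltn_eqF // (leq_ltn_trans pi).
(* Row [p] of the lower factor is supported on the distinct columns [p] and [j], so two terms
   survive. *)
rewrite (bigD1 p) // (bigD1 j) 1?eq_sym //= big1 => [|l /andP[lp lj]]; last first.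
  by rewrite !mxE pi eq_sym (negPf lp) (negPf lj) andbF muln0 mul0r.
rewrite !mxE pi leqNgt ij /= (negPf pj) !eqxx andbF andbT (eq_sym j).
have [->|_] /= := eqVneq p i; have [->|_] /= := eqVneq q j.
all: rewrite -?natrDE -?natrME; lia.
Qed.

Lemma lower_factor_ij a : lower_factor a i j = a.
Proof. by rewrite mxE leqnn !eqxx -val_eqE ltn_eqF // muln1. Qed.

Lemma upper_factor_ij a : upper_factor a i j = x i j - a.
Proof. by rewrite mxE leqnn !eqxx muln1. Qed.

Lemma lower_factor_Umon a : Umon n (lower_factor a).
Proof.
have [xlow xdiag] := Ux; split=> [p q qp|p]; rewrite mxE.
  case: ifP => pi; last exact: xlow.
  have := ij; rewrite -!val_eqE /=; lia.
by case: ifP => pi //; have := ij; rewrite -!val_eqE /=; lia.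
Qed.

Lemma upper_factor_Umon a : Umon n (upper_factor a).
Proof.
have [xlow xdiag] := Ux; split=> [p q qp|p]; rewrite mxE.
  case: ifP => pi; first by rewrite xlow.
  by rewrite -val_eqE gtn_eqF.
case: ifP => pi; last by rewrite eqxx.
by rewrite xdiag; have := ij; rewrite -!val_eqE /=; lia.
Qed.

(** In the case of [Pmon], the positive entry forces [i] to be the first row, and both factors are
    then the identity below it. *)
Lemma factors_carrier t a : 0 < x i j -> carrier t n x ->
  carrier t n (lower_factor a) /\ carrier t n (upper_factor a).
Proof.
case: t => [_ _|xij [_ xP]] /=.
  by split; [exact: lower_factor_Umon | exact: upper_factor_Umon].
have i0 : i = 0 :> nat.
  apply/eqP; apply: contraTT xij => /negP i0.
  by rewrite xP //; [rewrite -val_eqE ltn_eqF | apply/negP].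
split; split; [exact: lower_factor_Umon | | exact: upper_factor_Umon | ];
  move=> p q pq p0; rewrite mxE i0 leqn0 (negPf p0).
  exact: xP.
by rewrite (negPf pq).
Qed.

End Factorization.

Definition above_diag (t : ambient) (n : nat) : pred ('I_n * 'I_n) :=
  fun p => (p.1 < p.2) && (if t is AmbU then true else (p.1 : nat) == 0).

Lemma card_above_diag t n : #|above_diag t n| = ambient_dim t n.
Proof.
rewrite -sum1_card (eq_bigl (fun p => above_diag t n (p.1, p.2))); last by case.
rewrite -(pair_big_dep xpredT (fun i j => above_diag t n (i, j))
  (fun _ _ => 1)).
(* Count by columns: column [j] contributes [j] positions for [Umon], and one if [j > 0] for
   [Pmon]. *)
rewrite (exchange_big_dep xpredT) //= /above_diag; case: t => /=.
  rewrite -bin2_sum big_mkord; apply: eq_bigr => j _.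
  under eq_bigl do rewrite andbT.
  by rewrite -(big_ord_widen _ (fun=> 1)) ?sum1_card ?card_ord // ltnW.
case: n => [|n]; first by rewrite big_ord0.
rewrite big_ord_recl big_pred0 // add0n /=.
rewrite (eq_bigr (fun=> 1)) => [|j _]; first by rewrite sum1_card card_ord.
by rewrite (big_pred1 ord0) // => -[[|i] ?] //=; rewrite andbF.
Qed.

(** Digits range over ['I_r.+1], inhabited as [inord] requires; below, [r] is the generating number
    minus one. The default [ord0] lets [pffun_on] count the digit functions. *)
Definition digits {n : nat} (r : nat) (x : 'M[nat]_n) :
    {ffun 'I_n * 'I_n -> 'I_r.+1} :=
  [ffun p : 'I_n * 'I_n => if p.1 < p.2 then inord (x p.1 p.2) else ord0].

Lemma digits_inj n r (x y : 'M[nat]_n) : Umon n x -> Umon n y ->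
  (forall i j : 'I_n, i < j -> x i j <= r) ->
  (forall i j : 'I_n, i < j -> y i j <= r) ->
  digits r x = digits r y -> x = y.
Proof.
move=> [xlow xdiag] [ylow ydiag] xr yr /ffunP xy.
apply/matrixP => i j; have [ij|ji|/val_inj <-] := ltngtP i j.
- move: (xy (i, j)); rewrite !ffunE /= ij => /(congr1 val) /=.
  by rewrite !inordK // ltnS ?xr ?yr.
- by rewrite xlow ?ylow.
- by rewrite xdiag ydiag.
Qed.

Lemma digits_support t n r x : carrier t n x ->
  digits r x \in pffun_on ord0 (above_diag t n) predT.
Proof.
move=> Mx; apply/pffun_onP; split=> //; apply/fintype.subsetP => -[i j].
rewrite !inE ffunE unfold_in /above_diag /=; case: ifP => // ij.
case: t Mx => //= -[_ xP]; apply: contraR => i0.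
by rewrite xP //; [rewrite -val_eqE /= inordK | rewrite -val_eqE ltn_eqF].
Qed.

Section Bounds.
Variables (t : ambient) (n : nat) (S : set 'M[nat]_n).
Hypothesis hS : unipotent_numerical_monoid (carrier t n) S.

Let M := carrier t n.
Let r := generating_number M S.

Lemma carrier_Umon x : M x -> Umon n x.
Proof. by rewrite /M; case: t => // -[]. Qed.

Lemma carrier1 : M 1%:M%R.
Proof. by case: hS => -[SM S1 _] _; apply: SM. Qed.

Lemma mem_gaps x : (x \in fset_set (M `\` S)) = `[< M x /\ ~ S x >].
Proof. by case: hS => _ fMS; rewrite in_fset_set // inE. Qed.

Lemma leq_genus {I : finType} (A : pred I) (f : I -> 'M[nat]_n) :
  {in A &, injective f} -> (forall a, A a -> M (f a) /\ ~ S (f a)) ->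
  #|A| <= genus M S.
Proof.
move=> finj fgap; rewrite cardE -(size_map f).
apply: uniq_leq_size.
  rewrite map_inj_in_uniq ?enum_uniq // => a b.
  by rewrite !mem_enum; apply: finj.
move=> _ /mapP[a + ->]; rewrite mem_enum => Aa.
by rewrite mem_gaps; apply/asboolP/fgap.
Qed.

Lemma gap_max_entry x : M x -> ~ S x -> max_entry x < r.
Proof.
have [[r0 rS] _] := generating_numberP _ _ hS.
move=> Mx nSx; rewrite ltnNge; apply/negP => rx; apply: nSx; apply: rS.
by split=> //; left; split=> //; exact: carrier_Umon.
Qed.

Lemma genus_lt_conductor : genus M S < conductor t S.
Proof.
have [[r0 _] _] := generating_numberP _ _ hS.
rewrite /conductor -/M -/r -card_above_diag.
have rE : r = r.-1.+1 by rewrite prednK.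
rewrite {1}rE -[r.-1.+1]card_ord -(card_pffun_on ord0).
set D := pffun_on _ _ _.
have D1 : digits r.-1 (1%:M%R : 'M[nat]_n) \in D by exact/digits_support/carrier1.
(* Setting aside the digits of the identity, which is no gap, makes the inequality strict. *)
rewrite (cardD1 (digits r.-1 1%:M%R)) D1 ltnS /genus.
set G := fset_set _.
have gapP x : x \in G ->
    [/\ M x, ~ S x & forall i j : 'I_n, i < j -> x i j <= r.-1].
  rewrite mem_gaps => /asboolP[Mx nSx]; split=> // i j _.
  by rewrite -ltnS -rE (leq_ltn_trans (leq_max_entry _ _ _ _)) ?gap_max_entry.
rewrite -(size_map (digits r.-1)) cardE; apply: uniq_leq_size.
  rewrite map_inj_in_uniq ?fset_uniq // => x y /gapP[Mx _ xr] /gapP[My _ yr].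
  by apply: digits_inj => //; apply: carrier_Umon.
move=> _ /mapP[x /gapP[Mx nSx xr] ->].
rewrite mem_enum; apply/andP; split; last exact: digits_support.
apply: contra_notN nSx => /eqP x1; suff -> : x = 1%:M%R by case: hS => -[].
apply: digits_inj x1 => //; [exact: carrier_Umon|exact/carrier_Umon/carrier1|].
by move=> i j ij; rewrite mxE -val_eqE ltn_eqF.
Qed.

Lemma leq_double_genus : 1 < r -> r <= (genus M S).*2.
Proof.
have [[_ S1 SM] _] := hS.
have [_ rmin] := generating_numberP _ _ hS.
move=> r1.
have [x [Mx nSx rx]] : exists x, [/\ M x, ~ S x & r.-1 <= max_entry x].
  (* Without such a gap, [r.-1], positive since [1 < r], would contradict the minimality of [r]. *)
  apply: contrapT => nex; have : r <= r.-1; last by lia.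
  apply: rmin; split=> [|x [[[_ rx]|-> //] Mx]]; first by lia.
  by apply: contrapT => nSx; apply: nex; exists x.
have Ux := carrier_Umon _ Mx.
have x1 : x <> 1%:M%R by move=> xE; apply: nSx; rewrite xE.
have [i [j [ij xij]]] := Umon_large_entry _ _ _ Ux x1 rx.
have facM (a : 'I_r) := factors_carrier _ _ _ _ Ux ij t a ltac:(lia) Mx.
(* Off [A] the lower factors are gaps; on [A] the upper ones are, since otherwise [x] would lie in
   [S]. Each family is injective, so each part has at most [genus M S] elements. *)
pose A (a : 'I_r) := `[< S (lower_factor _ x i j a) >].
have ax (a : 'I_r) : a <= x i j by have := ltn_ord a; lia.
rewrite -[r in r <= _]card_ord -(cardC A) -addnn addnC leq_add //.
  apply: (leq_genus [predC A] (lower_factor _ x i j)) => [a b _ _ ab|a nA].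
    apply: val_inj => /=.
    by rewrite -(lower_factor_ij _ x _ _ ij a) ab lower_factor_ij.
  split; first by case: (facM a).
  exact/asboolPn.
apply: (leq_genus A (upper_factor _ x i j)) => [a b _ _ ab|a /asboolP Sa].
  apply: val_inj => /=; have := congr1 (fun y : 'M_n => y i j) ab.
  by rewrite !upper_factor_ij //; have := ax a; have := ax b; lia.
split=> [|Sb]; first by case: (facM a).
by apply: nSx; rewrite -(factorsK _ _ _ _ Ux ij a (ax a)); apply: SM.
Qed.

End Bounds.

Theorem theorem1p11 (n : nat) (hn : 2 <= n) (t : ambient)
    (S : set 'M[nat]_n) (hS : unipotent_numerical_monoid (carrier t n) S) :
  generating_number (carrier t n) S %/ 2 <= genus (carrier t n) S /\
  genus (carrier t n) S < conductor t S.
Proof.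
split; last exact: genus_lt_conductor.
(* The doubled bound fails at generating number [1], where [S] is the whole carrier; there the floor
   is [0]. *)
have [r1|r1] := leqP (generating_number (carrier t n) S) 1.
  by rewrite divn_small.
apply: leq_trans (leq_div2r 2 (leq_double_genus _ _ _ hS r1)) _.
by rewrite -muln2 mulnK.
Qed.
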